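(* Let $\bm A\in\mathbb R^{m\times n}$, $\bm D\in\mathbb R^{n\times d}$ with $\bm D\bm D^\top=\bm I_n$, $0<\alpha\le1$, $\lambda>0$, $\mu>0$, let $s\ge2$ be an integer, and let $\bm b=\bm A\bm x+\bm e$ with $\bm x\in\mathbb R^n$, $\|\bm e\|_2\le\lambda$. Let $T$ be an index set of $s$ largest-magnitude entries of $\bm D^\top\bm x$, and let $(\hat{\bm x},\hat{\bm z})$ be a minimizer of $$\min_{\bm x\in\mathbb R^n,\ \bm z\in\mathbb R^d}\ \lambda(\|\bm z\|_1-\alpha\|\bm z\|_2)+\tfrac12\|\bm A\bm x-\bm b\|_2^2+\tfrac{\mu}2\|\bm D^\top\bm x-\bm z\|_2^2.$$ Set $K=\sqrt{\frac{\alpha+\sqrt s}{\sqrt s}+\frac{\alpha^2}{4s}}+\frac{\alpha+1}{2\sqrt s}+1$ and $W=2\|\bm D_{T^c}^\top\bm x\|_1+\frac{(\alpha+1)^2d}{2}\frac{\lambda}{\mu}$. (i) Let $t\ge3$ be real and suppose $\rho:=\rho_{s,t}=\delta_{ts}+\sqrt{\frac{\lceil(t-1)s\rceil}{(t-1)^2s}}\frac{(\sqrt2+1)(\sqrt s+\alpha)}{\sqrt2(\sqrt s-1)}\theta_{ts,(t-1)s}<1$. Set $\delta:=\delta_{ts}$, $\tau=\frac{(\sqrt2+1)\theta_{ts,(t-1)s}}{\sqrt2(1-\rho)}\frac{\sqrt{(t-1)s}}{(t-1)(s-\sqrt s)}$, $C=1+\frac{(\sqrt2+1)\theta_{ts,(t-1)s}}{\sqrt2(1-\rho)}\frac{\sqrt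 s+\alpha}{s-\sqrt s}\frac{\sqrt{(t-1)s}}{t-1}$, $Q=C(1-\rho)+(\sqrt s+\alpha)\sqrt{1+\delta}$. Then $$\|\hat{\bm x}-\bm x\|_2\le\Big(K\Big(\tau+\frac{(\tau(1-\rho)+\sqrt{1+\delta})C}{Q}\Big)+\frac12\Big(1+\frac{C(1-\rho)}{Q}\Big)\Big)W+\Big(K\frac{\tau(1-\rho)+\sqrt{1+\delta}}{1-\rho}+\frac12\Big)\Big(C+\frac{(\sqrt s+\alpha)\sqrt{1+\delta}}{1-\rho}\Big)2\lambda.$$ (ii) Suppose instead $\rho:=\rho_s=\delta_s+\frac{(\sqrt2+1)(\sqrt s+\alpha)}{\sqrt2(\sqrt s-1)}\theta_{s,s}<1$, and set $\delta:=\delta_s$, $\tau=\frac{(\sqrt2+1)\theta_{s,s}}{\sqrt2(1-\rho)}\frac1{\sqrt s-1}$, $C=1+\frac{(\sqrt2+1)\theta_{s,s}}{\sqrt2(1-\rho)}\frac{\sqrt s+\alpha}{\sqrt s-1}$, $Q=C(1-\rho)+(\sqrt s+\alpha)\sqrt{1+\delta}$. Then the same bound as in (i) holds with these $\rho,\delta,\tau,C,Q$.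
   Context: For an index set $S\subseteq\{1,\dots,d\}$, $S^c$ is its complement and $\bm D_S$ denotes $\bm D$ with all columns not indexed by $S$ set to zero (so $\bm D_{T^c}^\top\bm x$ is $\bm D^\top\bm x$ with entries in $T$ set to zero). A vector is $s$-sparse if it has at most $s$ nonzero entries. $\delta_s$ (the $\bm D$-RIC) is the smallest $\delta\ge0$ with $(1-\delta)\|\bm D\bm v\|_2^2\le\|\bm A\bm D\bm v\|_2^2\le(1+\delta)\|\bm D\bm v\|_2^2$ for all $s$-sparse $\bm v\in\mathbb R^d$; $\theta_{s,t}$ (the $\bm D$-ROC) is the smallest nonnegative number with $|\langle\bm A\bm D\bm u,\bm A\bm D\bm v\rangle-\langle\bm D\bm u,\bm D\bm v\rangle|\le\theta_{s,t}\|\bm u\|_2\|\bm v\|_2$ for all $s$-sparse $\bm u$ and $t$-sparse $\bm v$ in $\mathbb R^d$. For non-integer orders, $\delta_{ts}:=\delta_{\lceil ts\rceil}$ and $\theta_{ts,(t-1)s}:=\theta_{\lceil ts\rceil,\lceil(t-1)s\rceil}$. *)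

(* Defs.v *)
From HB Require Import structures.
From mathcomp Require Import all_boot all_order all_algebra.
From mathcomp Require Import classical_sets reals.
Set Implicit Arguments. Unset Strict Implicit. Unset Printing Implicit Defensive.
Import Order.TTheory GRing.Theory Num.Theory.
Local Open Scope classical_set_scope.
Local Open Scope ring_scope.

Definition l2norm (R : realType) (k : nat) (v : 'cV[R]_k) : R :=
  Num.sqrt (\sum_(i < k) (v i ord0) ^+ 2).
Definition l1norm (R : realType) (k : nat) (v : 'cV[R]_k) : R :=
  \sum_(i < k) `|v i ord0|.
Definition inner (R : realType) (k : nat) (u v : 'cV[R]_k) : R :=
  \sum_(i < k) u i ord0 * v i ord0.

Definition sparse (R : realType) (k s : nat) (v : 'cV[R]_k) : Prop :=
  (#|[pred i | v i ord0 != 0%R]| <= s)%N.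

Definition DRIC (R : realType) (m n d : nat) (A : 'M[R]_(m, n)) (D : 'M[R]_(n, d))
  (s : nat) : R :=
  inf [set dl : R | 0 <= dl /\
    forall v : 'cV[R]_d, sparse s v ->
      (1 - dl) * l2norm (D *m v) ^+ 2 <= l2norm (A *m (D *m v)) ^+ 2 /\
      l2norm (A *m (D *m v)) ^+ 2 <= (1 + dl) * l2norm (D *m v) ^+ 2].

Definition DROC (R : realType) (m n d : nat) (A : 'M[R]_(m, n)) (D : 'M[R]_(n, d))
  (s t : nat) : R :=
  inf [set th : R | 0 <= th /\
    forall u v : 'cV[R]_d, sparse s u -> sparse t v ->
      `|inner (A *m (D *m u)) (A *m (D *m v)) - inner (D *m u) (D *m v)|
        <= th * l2norm u * l2norm v].

Definition nceil (R : realType) (x : R) : nat := absz (Num.ceil x).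

Definition objective (R : realType) (m n d : nat) (A : 'M[R]_(m, n)) (D : 'M[R]_(n, d))
  (b : 'cV[R]_m) (alpha lam mu : R) (x : 'cV[R]_n) (z : 'cV[R]_d) : R :=
  lam * (l1norm z - alpha * l2norm z) + 2^-1 * l2norm (A *m x - b) ^+ 2
  + mu / 2 * l2norm (D^T *m x - z) ^+ 2.

Definition Kconst (R : realType) (alpha : R) (s : nat) : R :=
  Num.sqrt ((alpha + Num.sqrt s%:R) / Num.sqrt s%:R + alpha ^+ 2 / (4 * s%:R))
  + (alpha + 1) / (2 * Num.sqrt s%:R) + 1.

Definition err_bound (R : realType) (alpha : R) (s : nat)
  (K W lam rho dl tau C Q : R) : R :=
  (K * (tau + (tau * (1 - rho) + Num.sqrt (1 + dl)) * C / Q)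
     + 2^-1 * (1 + C * (1 - rho) / Q)) * W
  + (K * ((tau * (1 - rho) + Num.sqrt (1 + dl)) / (1 - rho)) + 2^-1)
    * (C + (Num.sqrt s%:R + alpha) * Num.sqrt (1 + dl) / (1 - rho)) * (2 * lam).

(* Main.v *)
Require Import Defs.
From HB Require Import structures.
From mathcomp Require Import all_boot all_order all_algebra.
From mathcomp Require Import classical_sets reals.
From mathcomp Require Import ring lra.
Set Implicit Arguments. Unset Strict Implicit. Unset Printing Implicit Defensive.
Import Order.TTheory GRing.Theory Num.Theory.
Local Open Scope ring_scope.

(* Put [h = xh - x], [y = D^T h], [X = |A h|_2] and [sig = W + X].  Comparing
   the objective at [(xh, zh)] and [(x, D^T x)] yields a cone inequality
   [X^2 + 2 lam |y_Tc|_1 <= 2 lam (|y_T|_1 + alpha |y|_2 + W + X)], in which [T]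
   may be replaced by the set [U] of the [s] largest entries of [y].  Hence
   [|y|_2 <= K |y_U|_2 + sig / 2], and [v = y_Uc] satisfies
   [|v|_1 - alpha |v|_2 <= (s - sqrt s) vt] and [|v|_oo <= vt], so that
   [|v|_1 <= s vt].  Moving the entries of [v] exceeding [vt / (t - 1)] into [U],
   and cutting the remaining part into blocks of decreasing magnitude, the
   restricted isometry and orthogonality constants give
   [|y_U|_2 <= tau sig + sqrt (1 + dl) / (1 - rho) X].  The block decomposition
   loses a factor [3/2], and passing from [ceil ((t - 1) s)] to [(t - 1) s] a
   factor [9/8]; their product is below [(sqrt 2 + 1) / sqrt 2].  Feeding the
   bound on [y_U] back into the cone inequality bounds [X]. *)

(** * Inner products, Euclidean norms and tight frames *)

Lemma innerC (R : realType) k (u v : 'cV[R]_k) : inner u v = inner v u.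
Proof. by apply: eq_bigr => i _; rewrite mulrC. Qed.

Lemma innerDl (R : realType) k (u v w : 'cV[R]_k) :
  inner (u + v) w = inner u w + inner v w.
Proof. by rewrite -big_split; apply: eq_bigr => i _; rewrite mxE mulrDl. Qed.

Lemma innerDr (R : realType) k (u v w : 'cV[R]_k) :
  inner w (u + v) = inner w u + inner w v.
Proof. by rewrite innerC innerDl !(innerC w). Qed.

Lemma innerZl (R : realType) k c (u w : 'cV[R]_k) :
  inner (c *: u) w = c * inner u w.
Proof. by rewrite mulr_sumr; apply: eq_bigr => i _; rewrite mxE mulrA. Qed.

Lemma innerNl (R : realType) k (u w : 'cV[R]_k) : inner (- u) w = - inner u w.
Proof. by rewrite -scaleN1r innerZl mulN1r. Qed.

Lemma inner_tr (R : realType) m k (M : 'M[R]_(m, k)) u v :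
  inner (M *m u) v = inner u (M^T *m v).
Proof.
have E p (a c : 'cV[R]_p) : inner a c = (a^T *m c) ord0 ord0.
  by rewrite mxE; apply: eq_bigr => i _; rewrite mxE.
by rewrite !E trmx_mul mulmxA.
Qed.

Lemma l2norm_ge0 (R : realType) k (v : 'cV[R]_k) : 0 <= l2norm v.
Proof. exact: sqrtr_ge0. Qed.

Lemma sqr_l2norm (R : realType) k (v : 'cV[R]_k) : l2norm v ^+ 2 = inner v v.
Proof. by rewrite sqr_sqrtr // sumr_ge0 // => i _; exact: sqr_ge0. Qed.

Lemma l2normN (R : realType) k (v : 'cV[R]_k) : l2norm (- v) = l2norm v.
Proof. by congr Num.sqrt; apply: eq_bigr => i _; rewrite mxE sqrrN. Qed.

Lemma inner_le_l2norm (R : realType) k (u v : 'cV[R]_k) :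
  `|inner u v| <= l2norm u * l2norm v.
Proof.
have vv := sqr_l2norm v; have uu := sqr_l2norm u.
have v0 := l2norm_ge0 v; have u0 := l2norm_ge0 u.
rewrite -ler_sqr ?nnegrE ?mulr_ge0 // real_normK ?num_real // exprMn.
have [/eqP z|nz] := boolP (l2norm v == 0).
  suff -> : inner u v = 0 by rewrite expr0n mulr_ge0 ?sqr_ge0.
  rewrite innerC; apply: big1 => i _.
  have : \sum_(i < k) (v i ord0) ^+ 2 == 0.
    by rewrite -(sqr_sqrtr (sumr_ge0 _ (fun i _ => sqr_ge0 (v i ord0)))) // -/(l2norm v) z expr0n.
  rewrite psumr_eq0; last by move=> j _; exact: sqr_ge0.
  by move=> /allP /(_ i (mem_index_enum i)); rewrite /= sqrf_eq0 => /eqP ->; rewrite mul0r.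
(* [w] is [|v|^2] times the component of [u] orthogonal to [v]; the scaling avoids a division. *)
set w := l2norm v ^+ 2 *: u + (- inner u v) *: v.
have := sqr_ge0 (l2norm w); rewrite (sqr_l2norm w).
rewrite innerDl !innerDr !innerZl !(innerC _ (_ *: _)) !innerZl -uu -vv (innerC v u).
set a := l2norm u; set c := l2norm v; set p := inner u v.
have c0 : 0 < c ^+ 2 by rewrite exprn_gt0 // lt0r nz.
move=> H; rewrite -subr_ge0 -(pmulr_rge0 _ c0).
by apply: le_trans H _; rewrite le_eqVlt; apply/orP; left; apply/eqP; ring.
Qed.

Lemma l2normD (R : realType) k (u v : 'cV[R]_k) :
  l2norm (u + v) <= l2norm u + l2norm v.
Proof.
rewrite -ler_sqr ?nnegrE ?addr_ge0 ?l2norm_ge0 //.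
rewrite sqr_l2norm innerDl !innerDr (innerC v u) -!sqr_l2norm sqrrD.
have := le_trans (ler_norm _) (inner_le_l2norm u v); lra.
Qed.

(** A crude bound by the Frobenius norm; it serves to show that admissible isometry and
    orthogonality constants exist. *)
Lemma l2norm_mulmx_bound (R : realType) m k (M : 'M[R]_(m, k)) :
  exists2 c, 0 <= c & forall v, l2norm (M *m v) ^+ 2 <= c * l2norm v ^+ 2.
Proof.
exists (\sum_i l2norm (row i M)^T ^+ 2); first by apply: sumr_ge0 => i _; exact: sqr_ge0.
move=> v; rewrite sqr_l2norm mulr_suml; apply: ler_sum => i _.
rewrite -expr2 -exprMn -[leLHS]real_normK ?num_real //.
have -> : (M *m v) i ord0 = inner (row i M)^T v.
  by rewrite mxE; apply: eq_bigr => j _; rewrite !mxE.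
by rewrite ler_sqr ?nnegrE ?mulr_ge0 ?l2norm_ge0 ?inner_le_l2norm.
Qed.

Lemma l2norm_tight_tr (R : realType) n d (D : 'M[R]_(n, d)) h :
  D *m D^T = 1%:M -> l2norm (D^T *m h) = l2norm h.
Proof.
move=> DD; apply/eqP; rewrite -(@eqrXn2 _ 2) ?l2norm_ge0 //.
by rewrite !sqr_l2norm inner_tr trmxK mulmxA DD mul1mx.
Qed.

(** Since [D^T] is an isometry, [|D u|^2 = <u, D^T D u> <= |u| |D u|]; divide by [|D u|]. *)
Lemma l2norm_tight_le (R : realType) n d (D : 'M[R]_(n, d)) u :
  D *m D^T = 1%:M -> l2norm (D *m u) <= l2norm u.
Proof.
move=> DD; have := le_trans (ler_norm _) (inner_le_l2norm u (D^T *m (D *m u))).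
rewrite -inner_tr -sqr_l2norm l2norm_tight_tr // expr2.
have := l2norm_ge0 (D *m u); rewrite le0r => /orP[/eqP -> _|p]; first exact: l2norm_ge0.
by rewrite ler_pM2r.
Qed.

(** * Restricted isometry and orthogonality constants as attained infima *)

Section Constants.
Context (R : realType) (m n d : nat) (A : 'M[R]_(m, n)) (D : 'M[R]_(n, d)).

Let DRIC_set s := [set dl : R | 0 <= dl /\
    forall v : 'cV[R]_d, sparse s v ->
      (1 - dl) * l2norm (D *m v) ^+ 2 <= l2norm (A *m (D *m v)) ^+ 2 /\
      l2norm (A *m (D *m v)) ^+ 2 <= (1 + dl) * l2norm (D *m v) ^+ 2]%classic.

(** Nonemptiness makes [inf] a genuine greatest lower bound instead of a default value. With
    [dl = 1 + c] the lower isometry inequality has a nonpositive left side, and the upper one is the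
    operator bound. *)
Let DRIC_nonempty s : (DRIC_set s !=set0)%classic.
Proof.
have [c c0 cP] := l2norm_mulmx_bound A; exists (1 + c); split; first by lra.
move=> v _; have := cP (D *m v); have := sqr_ge0 (l2norm (A *m (D *m v))).
have := sqr_ge0 (l2norm (D *m v)); have := sqr_ge0 (l2norm (A *m (D *m v))).
by move=> *; split; nra.
Qed.

Lemma DRIC_ge0 s : 0 <= DRIC A D s.
Proof. by apply: (lb_le_inf (DRIC_nonempty _)) => z []. Qed.

(** For fixed [v], dividing by [|D v|^2] turns both inequalities into lower bounds on the admissible
    constant, and these pass to the infimum. If [D v = 0], any single admissible constant settles
    the claim. *)
Lemma DRICP s v : sparse s v ->
  (1 - DRIC A D s) * l2norm (D *m v) ^+ 2 <= l2norm (A *m (D *m v)) ^+ 2 /\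
  l2norm (A *m (D *m v)) ^+ 2 <= (1 + DRIC A D s) * l2norm (D *m v) ^+ 2.
Proof.
move=> sv; set p := l2norm (D *m v) ^+ 2; set q := l2norm _ ^+ 2.
have q0 : 0 <= q by exact: sqr_ge0.
have := sqr_ge0 (l2norm (D *m v)); rewrite -/p le0r => /orP[/eqP p0|p0].
  have [z [_ /(_ _ sv)]] := DRIC_nonempty s; rewrite -/p -/q p0 !mulr0; lra.
have : 1 - q / p <= DRIC A D s.
  apply: (lb_le_inf (DRIC_nonempty _)) => z [_ /(_ _ sv) []].
  by rewrite -/p -/q -ler_pdivlMr //; lra.
have : q / p - 1 <= DRIC A D s.
  apply: (lb_le_inf (DRIC_nonempty _)) => z [_ /(_ _ sv) [_]].
  by rewrite -/p -/q -ler_pdivrMr //; lra.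
move=> H1 H2; split; [rewrite -ler_pdivlMr // | rewrite -ler_pdivrMr //]; lra.
Qed.

Let DROC_set s t := [set th : R | 0 <= th /\
    forall u v : 'cV[R]_d, sparse s u -> sparse t v ->
      `|inner (A *m (D *m u)) (A *m (D *m v)) - inner (D *m u) (D *m v)|
        <= th * l2norm u * l2norm v]%classic.

Context (DD : D *m D^T = 1%:M).

(** The defining inequality is measured in [|u|] and [|v|], so the tight frame is used to bound
    [|D u|] by [|u|]. *)
Let DROC_nonempty s t : (DROC_set s t !=set0)%classic.
Proof.
have [c c0 cP] := l2norm_mulmx_bound A; exists (c + 1); split; first by lra.
move=> u v _ _.
have E z : l2norm (A *m (D *m z)) <= Num.sqrt c * l2norm z.
  rewrite -ler_sqr ?nnegrE ?mulr_ge0 ?sqrtr_ge0 ?l2norm_ge0 // exprMn (sqr_sqrtr c0).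
  apply: (le_trans (cP _)); apply: ler_wpM2l => //.
  by rewrite ler_sqr ?nnegrE ?l2norm_ge0 ?l2norm_tight_le.
apply: (le_trans (ler_normB _ _)); rewrite !mulrDl mul1r; apply: lerD.
  apply: (le_trans (inner_le_l2norm _ _)).
  apply: (le_trans (ler_pM (l2norm_ge0 _) (l2norm_ge0 _) (E u) (E v))).
  by rewrite mulrACA -expr2 (sqr_sqrtr c0) mulrA.
apply: (le_trans (inner_le_l2norm _ _)).
by apply: ler_pM; rewrite ?l2norm_ge0 ?l2norm_tight_le.
Qed.

Lemma DROC_ge0 s t : 0 <= DROC A D s t.
Proof. by apply: (lb_le_inf (DROC_nonempty _ _)) => z []. Qed.

Lemma DROCP s t u v : sparse s u -> sparse t v ->
  `|inner (A *m (D *m u)) (A *m (D *m v)) - inner (D *m u) (D *m v)|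
    <= DROC A D s t * l2norm u * l2norm v.
Proof.
move=> su tv; rewrite -mulrA.
have := mulr_ge0 (l2norm_ge0 u) (l2norm_ge0 v).
set p := _ * _; set q := `|_|; rewrite le0r => /orP[/eqP p0|p0].
  have [z [_ /(_ _ _ su tv)]] := DROC_nonempty s t.
  by rewrite -/q -mulrA -/p p0 !mulr0.
rewrite -ler_pdivrMr //; apply: (lb_le_inf (DROC_nonempty _ _)) => z [_ /(_ _ _ su tv)].
by rewrite -/q -mulrA -/p -ler_pdivrMr.
Qed.

End Constants.

(** * Restriction of a vector to an index set *)

Definition restr (R : realType) d (S : {set 'I_d}) (v : 'cV[R]_d) : 'cV[R]_d :=
  \col_i (if i \in S then v i ord0 else 0).

Lemma restrU (R : realType) d (S U : {set 'I_d}) (v : 'cV[R]_d) :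
  [disjoint S & U] -> restr (S :|: U) v = restr S v + restr U v.
Proof.
move=> dSU; apply/colP => i; rewrite !mxE inE.
have [iS|_] := boolP (i \in S); last by rewrite add0r.
by rewrite (disjointFr dSU iS) addr0.
Qed.

Lemma restrC (R : realType) d (S : {set 'I_d}) (v : 'cV[R]_d) :
  restr S v + restr (~: S) v = v.
Proof.
by apply/colP => i; rewrite !mxE inE; case: ifP; rewrite ?addr0 ?add0r.
Qed.

Lemma inner_restrl (R : realType) d (S : {set 'I_d}) (u v : 'cV[R]_d) :
  inner (restr S u) v = \sum_(i in S) u i ord0 * v i ord0.
Proof.
rewrite [RHS]big_mkcond; apply: eq_bigr => i _; rewrite mxE.
by case: ifP; rewrite ?mul0r.
Qed.

Lemma inner_restr (R : realType) d (S : {set 'I_d}) (v : 'cV[R]_d) :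
  inner (restr S v) v = l2norm (restr S v) ^+ 2.
Proof.
by rewrite sqr_l2norm !inner_restrl; apply: eq_bigr => i iS; rewrite mxE iS.
Qed.

Lemma sqr_l2norm_restr (R : realType) d (S : {set 'I_d}) (v : 'cV[R]_d) :
  l2norm (restr S v) ^+ 2 = \sum_(i in S) v i ord0 ^+ 2.
Proof. by rewrite -inner_restr inner_restrl. Qed.

Lemma sparse_restr (R : realType) d k (S : {set 'I_d}) (v : 'cV[R]_d) :
  (#|S| <= k)%N -> sparse k (restr S v).
Proof.
apply: leq_trans; apply: subset_leq_card; apply/fintype.subsetP => i.
by rewrite inE mxE; case: ifP => //; rewrite eqxx.
Qed.

Lemma l2norm_restr_mono (R : realType) d (S U : {set 'I_d}) (v : 'cV[R]_d) :
  S \subset U -> l2norm (restr S v) <= l2norm (restr U v).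
Proof.
move=> SU; rewrite -ler_sqr ?nnegrE ?l2norm_ge0 // !sqr_l2norm_restr.
rewrite [leRHS](big_setID S) (finset.setIidPr SU) /= lerDl.
by apply: sumr_ge0 => i _; exact: sqr_ge0.
Qed.

(** Cauchy-Schwarz against the sign vector of [v] on [S], whose squared norm is at most [#|S|]. *)
Lemma sum_abs_le_l2norm (R : realType) d (S : {set 'I_d}) (v : 'cV[R]_d) :
  \sum_(i in S) `|v i ord0| <= Num.sqrt #|S|%:R * l2norm (restr S v).
Proof.
pose u : 'cV[R]_d := \col_i (if i \in S then Num.sg (v i ord0) else 0).
have E : \sum_(i in S) `|v i ord0| = inner u (restr S v).
  rewrite /inner [RHS](bigID (mem S)) /= [X in _ = _ + X]big1 ?addr0.
    by apply: eq_bigr => i iS; rewrite !mxE iS normrEsg.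
  by move=> i /negbTE iS; rewrite !mxE iS mul0r.
rewrite E; apply: (le_trans (ler_norm _)); apply: (le_trans (inner_le_l2norm _ _)).
apply: ler_wpM2r; first exact: l2norm_ge0.
apply: ler_wsqrtr; rewrite -sum1_card natr_sum [leRHS]big_mkcond /=.
apply: ler_sum => i _; rewrite mxE; case: ifP; last by rewrite expr0n.
by move=> _; rewrite sqr_sg; case: (_ != 0).
Qed.

(** * Sets of largest entries, block decomposition and l1 estimates *)

(** Greedy choice: a maximizer over the remaining indices is added at each step. *)
Lemma exists_top (R : realType) (I : finType) (f : I -> R) (S : {set I}) k :
  (k <= #|S|)%N -> exists U : {set I}, [/\ U \subset S, #|U| = k &
    forall i j, i \in U -> j \in S :\: U -> f j <= f i].
Proof.
elim: k => [_|k IH kS].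
  by exists finset.set0; split; rewrite ?finset.sub0set ?cards0 // => i j; rewrite inE.
have [U [US cU Umax]] := IH (ltnW kS).
have /card_gt0P [i0 i0P] : (0 < #|S :\: U|)%N.
  by rewrite cardsD (finset.setIidPr US) cU subn_gt0.
case: (@arg_maxP _ _ _ i0 (mem (S :\: U)) f i0P) => i /finset.setDP [iS iU] imax.
exists (i |: U); split.
- by rewrite finset.subUset finset.sub1set iS US.
- by rewrite cardsU1 iU cU.
move=> a j /finset.setU1P [->|aU]; rewrite !inE negb_or -andbA => /and3P [_ jU jS].
  by apply: imax; apply/finset.setDP.
by apply: Umax; rewrite // inE jU.
Qed.

Lemma cards_le_sum (R : realType) (I : finType) (f : I -> R) (S : {set I}) (c : R) :
  (forall i, i \in S -> c <= f i) -> #|S|%:R * c <= \sum_(i in S) f i.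
Proof.
by move=> cf; rewrite mulr_natl -sumr_const; apply: ler_sum.
Qed.

Lemma sqr_l2norm_le_max (R : realType) d (S : {set 'I_d}) (v : 'cV[R]_d) vt :
  (forall i, i \in S -> `|v i ord0| <= vt) ->
  l2norm (restr S v) ^+ 2 <= vt * \sum_(i in S) `|v i ord0|.
Proof.
move=> vP; rewrite sqr_l2norm_restr mulr_sumr; apply: ler_sum => i iS.
by rewrite -real_normK ?num_real // expr2 ler_wpM2r // vP.
Qed.

(* AM-GM on [|v|_2^2 <= vt |v|_1] *)
Lemma l2norm_restr_amgm (R : realType) d (S : {set 'I_d}) (v : 'cV[R]_d) (q vt : R) :
  0 < q -> 0 <= vt -> (forall i, i \in S -> `|v i ord0| <= vt) ->
  l2norm (restr S v) <= (q * vt + (\sum_(i in S) `|v i ord0|) / q) / 2.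
Proof.
move=> q0 vt0 vP; have := sqr_l2norm_le_max vP; set L := \sum_(i in S) _ => H.
have L0 : 0 <= L / q by rewrite divr_ge0 ?sumr_ge0 // ltW.
have qv : 0 <= q * vt by rewrite mulr_ge0 // ltW.
rewrite -ler_sqr ?nnegrE ?l2norm_ge0 ?divr_ge0 ?addr_ge0 //.
apply: (le_trans H); have -> : vt * L = (q * vt) * (L / q) by field; rewrite gt_eqF.
have := sqr_ge0 (q * vt - L / q); set a := q * vt; set c := L / q; nra.
Qed.

(* Peel off blocks of [k] largest entries: the sup norm of each block is at
   most the mean of the previous one, so the sup norms telescope into the
   l1 norm. *)
Lemma subadditive_le_of_sparse (R : realType) d (F : 'cV[R]_d -> R) (c vt : R)
    (k : nat) (v : 'cV[R]_d) (S : {set 'I_d}) :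
  (0 < k)%N -> 0 <= c -> (forall u w, F (u + w) <= F u + F w) ->
  (forall u, sparse k u -> F u <= c * l2norm u) ->
  0 <= vt -> (forall i, i \in S -> `|v i ord0| <= vt) ->
  F (restr S v) <= c * (Num.sqrt k%:R * vt / 2
                        + (\sum_(i in S) `|v i ord0|) / Num.sqrt k%:R).
Proof.
move=> k0 c0 Fsub Fsp; set q : R := Num.sqrt k%:R.
have q0 : 0 < q by rewrite sqrtr_gt0 ltr0n.
have qq : k%:R = q * q by rewrite -expr2 sqr_sqrtr ?ler0n.
elim: {S}_.+1 {-2}S vt (ltnSn #|S|) => // N IH S vt SN vt0 vP.
have [Sk|kS] := leqP #|S| k.
  apply: (le_trans (Fsp _ (sparse_restr _ Sk))); apply: ler_wpM2l => //.
  apply: (le_trans (l2norm_restr_amgm q0 vt0 vP)).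
  have : 0 <= (\sum_(i in S) `|v i ord0|) / q by rewrite divr_ge0 ?sumr_ge0 // ltW.
  lra.
have [U [US cU Umax]] := exists_top (fun i => `|v i ord0|) (ltnW kS).
have ES : S = U :|: (S :\: U).
  apply/setP=> i; by rewrite !inE; case: (boolP (i \in U)) => [/(fintype.subsetP US) ->|].
have dis : [disjoint U & S :\: U].
  by rewrite -finset.setI_eq0; apply/eqP/setP=> i; rewrite !inE; case: (i \in U).
set L1 := \sum_(i in U) `|v i ord0|.
have L10 : 0 <= L1 by rewrite sumr_ge0.
set vt' := L1 / k%:R.
have vt'0 : 0 <= vt' by rewrite divr_ge0 // ler0n.
have vP' i : i \in S :\: U -> `|v i ord0| <= vt'.
  move=> iSU; rewrite ler_pdivlMr ?ltr0n // mulrC -cU.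
  by apply: cards_le_sum => j jU; exact: Umax.
have cSU : (#|S :\: U| < N)%N.
  rewrite cardsD (finset.setIidPr US) cU; apply: leq_trans (_ : #|S| <= N)%N => //.
  by rewrite ltn_subLR ?(ltnW kS) // -{1}[#|S|]add0n ltn_add2r.
have H := IH _ _ cSU vt'0 vP'.
rewrite {1}ES restrU //; apply: (le_trans (Fsub _ _)).
have U1 := Fsp _ (sparse_restr v (eq_leq cU)).
have vPU i : i \in U -> `|v i ord0| <= vt by move=> /(fintype.subsetP US); exact: vP.
have U2 := l2norm_restr_amgm q0 vt0 vPU.
have -> : \sum_(i in S) `|v i ord0| = L1 + \sum_(i in S :\: U) `|v i ord0|.
  by rewrite (big_setID U) (finset.setIidPr US).
apply: (le_trans (lerD (le_trans U1 (ler_wpM2l c0 U2)) H)).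
(* As [vt' = L1 / k], the sup term of the remainder is [L1 / (2 q)]; with the other half coming from
   AM-GM on the block [U] it makes exactly [L1 / q]. *)
rewrite -mulrDr; apply: ler_wpM2l => //; rewrite /vt' qq -/L1.
set L2 := \sum_(i in _ :\: _) _.
by rewrite le_eqVlt; apply/orP; left; apply/eqP; field; rewrite gt_eqF.
Qed.

(* With [L = |v|_1], the hypotheses give [|v|_2 <= sqrt (vt L)], and
   [L - sqrt (vt L)] increases in [L] beyond [s vt]. *)
Lemma l1norm_le_of_l1_sub_l2 (R : realType) d (S : {set 'I_d}) (v : 'cV[R]_d)
    (alpha vt : R) (s : nat) :
  (1 <= s)%N -> alpha <= 1 -> 0 <= vt ->
  (forall i, i \in S -> `|v i ord0| <= vt) ->
  \sum_(i in S) `|v i ord0| - alpha * l2norm (restr S v)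
    <= (s%:R - Num.sqrt s%:R) * vt ->
  \sum_(i in S) `|v i ord0| <= s%:R * vt.
Proof.
move=> s1 a1 vt0 vP; have := sqr_l2norm_le_max vP.
have : 0 <= \sum_(i in S) `|v i ord0| by rewrite sumr_ge0.
have := l2norm_ge0 (restr S v).
set L := \sum_(i in S) _; set b := l2norm _ => b0 L0 bL H.
move: H; set q : R := Num.sqrt _ => H.
have qq : s%:R = q ^+ 2 by rewrite sqr_sqrtr ?ler0n.
have q1 : 1 <= q by rewrite -[leLHS]sqrtr1 ler_wsqrtr // ler1n.
rewrite leNgt; apply/negP; move: H; rewrite qq => H sL.
(* With [L = r^2] and [vt = p^2] the claim becomes polynomial: if [r > q p], then [r (r - p) > q p
   (q p - p) = (q^2 - q) p^2], against the hypothesis. *)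
have [r r0 Lr] : exists2 r, 0 <= r & L = r ^+ 2.
  by exists (Num.sqrt L); rewrite ?sqrtr_ge0 ?sqr_sqrtr.
have [p p0 vp] : exists2 p, 0 <= p & vt = p ^+ 2.
  by exists (Num.sqrt vt); rewrite ?sqrtr_ge0 ?sqr_sqrtr.
have br : b <= p * r.
  by rewrite -ler_sqr ?nnegrE ?mulr_ge0 // exprMn -Lr -vp.
have qr : q * p < r.
  rewrite -ltr_sqr ?nnegrE ?mulr_ge0 //; last lra.
  by rewrite exprMn -Lr -vp.
have ab : alpha * b <= p * r by apply: le_trans br; rewrite ler_piMl.
move: H; rewrite Lr vp; apply/negP; rewrite -ltNge.
have h1 : 0 <= (q - 1) * p by apply: mulr_ge0 => //; lra.
have h2 : (q * p) * ((q - 1) * p) <= r * ((q - 1) * p) by apply: ler_wpM2r => //; exact: ltW.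
have h3 : 0 <= q * p by apply: mulr_ge0 => //; lra.
have h4 : 0 < r * (r - q * p) by apply: mulr_gt0; lra.
have e1 : r * (r - q * p) = r ^+ 2 - r * (q * p) by ring.
have e2 : r * ((q - 1) * p) = r * (q * p) - p * r by ring.
have e3 : q * p * ((q - 1) * p) = (q ^+ 2 - q) * p ^+ 2 by ring.
lra.
Qed.

(** After cancelling [T :&: U], the two differences have the same size, and a threshold [c]
    separates the values outside [U] from those inside. *)
Lemma sum_le_top (R : realType) (I : finType) (f : I -> R) (T U : {set I}) :
  (forall i, 0 <= f i) -> #|T| = #|U| ->
  (forall i j, i \in U -> j \notin U -> f j <= f i) ->
  \sum_(i in T) f i <= \sum_(i in U) f i.
Proof.
(* The base value [0] of the maximum stays below every value on [U] because [f] is nonnegative. *)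
move=> f0 cTU Umax; pose c := \big[Order.max/0]_(j in ~: U) f j.
have cle i : i \in U -> c <= f i.
  move=> iU; apply: bigmax_le => // j; rewrite inE => jU; exact: Umax.
have cge j : j \in ~: U -> f j <= c by move=> jU; exact: le_bigmax_cond.
rewrite (big_setID U) [leRHS](big_setID T) finset.setIC lerD2l.
have cD : #|T :\: U| = #|U :\: T| by rewrite !cardsD finset.setIC cTU.
apply: (@le_trans _ _ (#|U :\: T|%:R * c)).
  rewrite -cD mulr_natl -sumr_const; apply: ler_sum => i.
  by rewrite !inE => /andP[iU _]; apply: cge; rewrite inE.
by apply: cards_le_sum => i; rewrite inE => /andP[_]; exact: cle.
Qed.

(** * Cone inequality from minimality, and the constant [K] *)

Lemma l1norm_le_l2norm (R : realType) d (w : 'cV[R]_d) :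
  l1norm w <= Num.sqrt d%:R * l2norm w.
Proof.
pose S : {set 'I_d} := ~: finset.set0.
have iS i : i \in S by rewrite !inE.
have E : restr S w = w by apply/colP => i; rewrite mxE iS.
have := sum_abs_le_l2norm S w; rewrite E cardsCs finset.setCK cards0 subn0 card_ord.
by rewrite (eq_bigl xpredT).
Qed.

(* Compare the objective at [(xh, zh)] and [(x, D^T x)]; the terms linear in
   [w = D^T xh - zh] are absorbed by [mu/2 |w|^2]. *)
Lemma objective_cone (R : realType) (m n d : nat) (A : 'M[R]_(m, n))
    (D : 'M[R]_(n, d)) (alpha lam mu : R) x e (T : {set 'I_d}) xh zh :
  (0 < d)%N -> 0 <= alpha -> 0 < lam -> 0 < mu -> l2norm e <= lam ->
  objective A D (A *m x + e) alpha lam mu xh zh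
    <= objective A D (A *m x + e) alpha lam mu x (D^T *m x) ->
  let y := D^T *m (xh - x) in let X := l2norm (A *m (xh - x)) in
  X ^+ 2 + 2 * lam * \sum_(i in ~: T) `|y i ord0| <=
  2 * lam * (\sum_(i in T) `|y i ord0| + alpha * l2norm y
             + (2 * (\sum_(i < d | i \notin T) `|(D^T *m x) i ord0|)
                + (alpha + 1) ^+ 2 * d%:R / 2 * (lam / mu)) + X).
Proof.
move=> d0 al0 lam0 mu0 elam; rewrite /objective; cbv zeta.
have -> : A *m x - (A *m x + e) = - e by rewrite opprD addrA subrr add0r.
have -> : A *m xh - (A *m x + e) = A *m (xh - x) - e by rewrite opprD addrA mulmxBr.
rewrite subrr.
have -> : l2norm (0 : 'cV[R]_d) = 0.
  by rewrite /l2norm big1 ?sqrtr0 // => i _; rewrite mxE expr0n.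
rewrite l2normN; set y := D^T *m (xh - x); set p := D^T *m x; set f := A *m (xh - x).
set w := D^T *m xh - zh.
have Ez : zh = p + y - w by rewrite /y /p /w mulmxBr; apply/colP => i; rewrite !mxE; ring.
have Ef : l2norm f ^+ 2 - 2 * lam * l2norm f + l2norm e ^+ 2 <= l2norm (f - e) ^+ 2.
  rewrite [leRHS]sqr_l2norm innerDl !innerDr !innerNl !(innerC _ (- e)) !innerNl.
  rewrite -!sqr_l2norm (innerC e f).
  have := le_trans (ler_norm _) (inner_le_l2norm f e).
  have := ler_wpM2l (l2norm_ge0 f) elam; lra.
have E2 : l2norm zh <= l2norm p + l2norm y + l2norm w.
  rewrite Ez; apply: (le_trans (l2normD _ _)); rewrite l2normN lerD2r.
  exact: l2normD.
(* Since [p + y = zh + w], the triangle inequality is used entrywise for [p] on [T] and for [y] off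
   [T]. *)
have E1 : l1norm p - 2 * \sum_(i < d | i \notin T) `|p i ord0| - \sum_(i in T) `|y i ord0|
    + \sum_(i in ~: T) `|y i ord0| - l1norm w <= l1norm zh.
  have -> : \sum_(i in ~: T) `|y i ord0| = \sum_(i < d | i \notin T) `|y i ord0|.
    by apply: eq_bigl => i; rewrite inE.
  rewrite lerBlDr -big_split /=.
  rewrite /l1norm (bigID (mem T)) [leRHS](bigID (mem T)) /=.
  have H1 : \sum_(i in T) `|p i ord0| - \sum_(i in T) `|y i ord0|
      <= \sum_(i in T) (`|zh i ord0| + `|w i ord0|).
    rewrite -sumrB; apply: ler_sum => i _.
    rewrite lerBlDr; have -> : p i ord0 = zh i ord0 + w i ord0 - y i ord0.
      by rewrite Ez !mxE; ring.
    by apply: (le_trans (ler_normB _ _)); rewrite lerD2r ler_normD.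
  have H2 : \sum_(i < d | i \notin T) `|y i ord0| - \sum_(i < d | i \notin T) `|p i ord0|
      <= \sum_(i < d | i \notin T) (`|zh i ord0| + `|w i ord0|).
    rewrite -sumrB; apply: ler_sum => i _.
    rewrite lerBlDr; have -> : y i ord0 = zh i ord0 + w i ord0 - p i ord0.
      by rewrite Ez !mxE; ring.
    by apply: (le_trans (ler_normB _ _)); rewrite lerD2r ler_normD.
  lra.
have W1 := l1norm_le_l2norm w.
move: Ef E2 E1 W1 (l2norm_ge0 w).
set S1 := \sum_(i in T) _; set S2 := \sum_(i in ~: T) _; set P := \sum_(i < d | _) _.
set X := l2norm f; set o := l2norm w; set q : R := Num.sqrt d%:R.
have qq : d%:R = q ^+ 2 by rewrite sqr_sqrtr ?ler0n.
have q1 : 1 <= q by rewrite -[leLHS]sqrtr1 ler_wsqrtr // ler1n.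
rewrite qq => Ef E2 E1 W1 o0 H.
have E2' := ler_wpM2l al0 E2.
have E3 : l1norm zh - alpha * l2norm zh >= l1norm p - alpha * l2norm p - 2 * P - S1 + S2
    - alpha * l2norm y - (q + alpha) * o by lra.
have E3' := ler_wpM2l (ltW lam0) E3.
(* Completing the square in [o], after [q + alpha <= (alpha + 1) q] (from [q >= 1]), produces the
   term in [lam / mu] of [W]. *)
have E4 : lam * ((q + alpha) * o) - mu / 2 * o ^+ 2
    <= lam * ((alpha + 1) ^+ 2 * q ^+ 2 / 2 * (lam / mu)).
  have h1 : (q + alpha) <= (alpha + 1) * q by nra.
  have h2 : lam * ((q + alpha) * o) <= lam * ((alpha + 1) * q * o).
    by apply: ler_wpM2l; [exact: ltW | exact: ler_wpM2r].
  have := mulr_ge0 (ltW mu0) (sqr_ge0 (o - lam * ((alpha + 1) * q) / mu)).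
  have -> : mu * (o - lam * ((alpha + 1) * q) / mu) ^+ 2 =
    mu * o ^+ 2 - 2 * (lam * ((alpha + 1) * q * o))
    + 2 * (lam * ((alpha + 1) ^+ 2 * q ^+ 2 / 2 * (lam / mu))).
    by field; rewrite gt_eqF.
  lra.
move: H E3' E4 Ef; set V := (alpha + 1) ^+ 2 * _ / 2 * _.
rewrite [0 ^+ 2]expr0n /= !mulr0 !addr0.
lra.
Qed.

(** Here [a] and [b] stand for the norms of [y] on [U] and off [U]. The hypothesis is quadratic in
    [b]; completing the square gives [(b - alpha a / (2 q))^2 <= a^2 p^2 + a sig / q], where [p] is
    the square root in [Kconst]. By AM-GM the right side is at most
    [(a p + (a / q + sig) / 2)^2]. *)
Lemma Kconst_bound (R : realType) (alpha a b sig : R) (s : nat) :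
  (0 < s)%N -> 0 <= alpha -> 0 <= a -> 0 <= sig ->
  b ^+ 2 <= a / Num.sqrt s%:R * (Num.sqrt s%:R * a + alpha * (a + b) + sig) ->
  a + b <= Kconst alpha s * a + sig / 2.
Proof.
move=> s0 al0 a0 sig0; rewrite /Kconst.
have qq : s%:R = Num.sqrt s%:R ^+ 2 :> R by rewrite sqr_sqrtr ?ler0n.
have : 0 < Num.sqrt s%:R :> R by rewrite sqrtr_gt0 ltr0n.
move: qq; set q : R := Num.sqrt _ => qq q0 H; rewrite qq.
set p := Num.sqrt _.
have p0 : 0 <= p by exact: sqrtr_ge0.
have pp : p ^+ 2 = (alpha + q) / q + alpha ^+ 2 / (4 * q ^+ 2).
  by rewrite sqr_sqrtr // addr_ge0 ?divr_ge0 ?addr_ge0 ?sqr_ge0 ?mulr_ge0 ?sqr_ge0 // ltW.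
suff : b - alpha * a / (2 * q) <= a * p + (a / q + sig) / 2.
  suff -> : alpha * a / (2 * q) = (alpha / (2 * q)) * a.
    have -> : a / q = 2 * (1 / (2 * q) * a) by field; rewrite gt_eqF.
    rewrite (mulrDl alpha); lra.
  by field; rewrite gt_eqF.
have aq : 0 <= a / q by rewrite divr_ge0 // ltW.
have ap : 0 <= a * p by rewrite mulr_ge0.
set r := _ + _ / 2; have r0 : 0 <= r by rewrite /r; lra.
apply: (le_trans (ler_norm _)); rewrite -[leRHS](ger0_norm r0).
rewrite -ler_sqr ?nnegrE // !real_normK ?num_real //.
have e1 : (b - alpha * a / (2 * q)) ^+ 2
    = b ^+ 2 - a / q * (q * a + alpha * (a + b) + sig) + a ^+ 2 * p ^+ 2 + a / q * sig.
  by rewrite pp; field; rewrite gt_eqF.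
have e2 : r ^+ 2 = a ^+ 2 * p ^+ 2 + a / q * sig
    + (a * p) * (a / q) + (a * p) * sig + ((a / q - sig) / 2) ^+ 2.
  by rewrite /r; field; rewrite gt_eqF.
rewrite e1 e2; have := sqr_ge0 ((a / q - sig) / 2).
have := mulr_ge0 ap aq; have := mulr_ge0 ap sig0; lra.
Qed.

(** * Isometry estimate on the leading entries, and the final algebra *)

(** Test [A h] against [A D u] with [u = y_U]. The tight frame gives [<D u, h> = <u, y> = |u|^2], so
    after splitting [h = D u + D v] only the isometry defect on [u] and the cross term [F v]
    separate [<A D u, A h>] from [|u|^2]. *)
Lemma rip_estimate (R : realType) (m n d : nat) (A : 'M[R]_(m, n))
    (D : 'M[R]_(n, d)) h (U : {set 'I_d}) (N k : nat) (vt : R) :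
  D *m D^T = 1%:M -> (0 < k)%N -> (#|U| <= N)%N -> 0 <= vt ->
  (forall i, i \in ~: U -> `|(D^T *m h) i ord0| <= vt) ->
  \sum_(i in ~: U) `|(D^T *m h) i ord0| <= k%:R * vt ->
  (1 - DRIC A D N) * l2norm (restr U (D^T *m h))
    <= Num.sqrt (1 + DRIC A D N) * l2norm (A *m h)
       + DROC A D N k * (3 / 2 * (Num.sqrt k%:R * vt)).
Proof.
move=> DD k0 cU vt0 ymax ysum; set y := D^T *m h in ymax ysum *.
have Dy : D *m y = h by rewrite mulmxA DD mul1mx.
set u := restr U y; set v := restr (~: U) y.
have su : sparse N u by exact: sparse_restr.
set dl := DRIC A D N; set th := DROC A D N k.
have dl0 : 0 <= dl by exact: DRIC_ge0.
have th0 : 0 <= th by exact: DROC_ge0.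
pose F w := `|inner (A *m (D *m u)) (A *m (D *m w)) - inner (D *m u) (D *m w)|.
have q0 : 0 < Num.sqrt k%:R :> R by rewrite sqrtr_gt0 ltr0n.
(* In the block estimate the sup norm contributes [1/2] and the sum, at most [k vt], contributes
   [1]: hence [3/2]. *)
have Fv : F v <= l2norm u * (th * (3 / 2 * (Num.sqrt k%:R * vt))).
  have c0 : 0 <= th * l2norm u by rewrite mulr_ge0 ?l2norm_ge0.
  apply: (@le_trans _ _ (th * l2norm u * (Num.sqrt k%:R * vt / 2
     + (\sum_(i in ~: U) `|y i ord0|) / Num.sqrt k%:R))).
    apply: subadditive_le_of_sparse => // [w1 w2|w sw]; last exact: DROCP.
    rewrite /F !mulmxDr !innerDr opprD addrACA; exact: ler_normD.
  rewrite mulrCA mulrA; apply: ler_wpM2l => //.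
  have : (\sum_(i in ~: U) `|y i ord0|) / Num.sqrt k%:R <= Num.sqrt k%:R * vt.
    rewrite ler_pdivrMr //; apply: (le_trans ysum).
    by rewrite mulrAC -expr2 sqr_sqrtr ?ler0n.
  lra.
have [lo up] := DRICP A D su.
have Du := l2norm_tight_le u DD.
have a0 := l2norm_ge0 u; have Du0 := l2norm_ge0 (D *m u).
have Eh : h = D *m u + D *m v by rewrite -mulmxDr restrC.
have E1 : l2norm u ^+ 2 = l2norm (D *m u) ^+ 2 + inner (D *m u) (D *m v).
  by rewrite -inner_restr -/u /y -inner_tr [X in inner _ X]Eh innerDr -sqr_l2norm.
have E2 : inner (A *m (D *m u)) (A *m h)
    = l2norm (A *m (D *m u)) ^+ 2 + inner (A *m (D *m u)) (A *m (D *m v)).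
  by rewrite {1}Eh mulmxDr innerDr -sqr_l2norm.
have E3 : inner (A *m (D *m u)) (A *m h) <= l2norm u * (Num.sqrt (1 + dl) * l2norm (A *m h)).
  apply: (le_trans (ler_norm _)); apply: (le_trans (inner_le_l2norm _ _)).
  rewrite mulrA; apply: ler_wpM2r; first exact: l2norm_ge0.
  rewrite -ler_sqr ?nnegrE ?mulr_ge0 ?sqrtr_ge0 ?l2norm_ge0 //.
  apply: (le_trans up); rewrite exprMn mulrC [X in _ <= _ * X]sqr_sqrtr;
    last by rewrite -/dl; lra.
  apply: ler_wpM2r; first by rewrite -/dl; lra.
  by rewrite ler_sqr ?nnegrE.
have E4 : - F v <= inner (A *m (D *m u)) (A *m (D *m v)) - inner (D *m u) (D *m v).
  exact: lerNnormlW.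
have E5 : dl * l2norm (D *m u) ^+ 2 <= dl * l2norm u ^+ 2.
  by apply: ler_wpM2l => //; rewrite ler_sqr ?nnegrE.
rewrite -/dl in lo.
have : l2norm u * ((1 - dl) * l2norm u)
    <= l2norm u * (Num.sqrt (1 + dl) * l2norm (A *m h) + th * (3 / 2 * (Num.sqrt k%:R * vt))).
  rewrite mulrDr; have -> : l2norm u * ((1 - dl) * l2norm u) = (1 - dl) * l2norm u ^+ 2 by ring.
  lra.
move: a0; rewrite le0r => /orP[/eqP -> _|a0]; last by rewrite ler_pM2l.
rewrite mulr0 addr_ge0 // mulr_ge0 ?sqrtr_ge0 ?l2norm_ge0 // !mulr_ge0 ?(ltW q0) //; lra.
Qed.

(** [E] is the cross term of [rip_estimate]. Its share proportional to [a'] moves to the left and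
    turns [1 - dl] into [1 - rho]; [a'] belongs to the possibly enlarged index set, [a] to [U]. *)
Lemma contraction_bound (R : realType) (a a' dl rho tau sig X E : R) :
  rho < 1 -> a <= a' ->
  (1 - dl) * a' <= Num.sqrt (1 + dl) * X + E ->
  E <= (rho - dl) * a' + (1 - rho) * (tau * sig) ->
  a <= tau * sig + Num.sqrt (1 + dl) / (1 - rho) * X.
Proof.
move=> r1 aa H1 H2; apply: (le_trans aa).
have r0 : 0 < 1 - rho by lra.
rewrite -(ler_pM2l r0) mulrDr.
have -> : (1 - rho) * (Num.sqrt (1 + dl) / (1 - rho) * X) = Num.sqrt (1 + dl) * X.
  by field; rewrite gt_eqF.
lra.
Qed.

(* The cone inequality becomes [X^2 <= 2 lam (G X + C W)] with
   [G = Q / (1 - rho)], whence [X <= C W / G + 2 lam G]. *)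
Lemma err_bound_ge (R : realType) (alpha lam K W X a N S1 S2 rho dl tau C Q : R)
    (s : nat) :
  0 < alpha -> alpha <= 1 -> 0 < lam -> 0 <= W -> 0 <= X -> 0 <= S2 ->
  0 <= K -> 0 <= tau -> rho < 1 ->
  X ^+ 2 + 2 * lam * S2 <= 2 * lam * (S1 + alpha * N + W + X) ->
  S1 <= Num.sqrt s%:R * a -> N <= a + S2 -> N <= K * a + (W + X) / 2 ->
  a <= tau * (W + X) + Num.sqrt (1 + dl) / (1 - rho) * X ->
  C = 1 + (Num.sqrt s%:R + alpha) * tau ->
  Q = C * (1 - rho) + (Num.sqrt s%:R + alpha) * Num.sqrt (1 + dl) ->
  N <= err_bound alpha s K W lam rho dl tau C Q.
Proof.
move=> al0 al1 lam0 W0 X0 S20 K0 tau0 r1 H S1a N1 N2 aX EC EQ.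
rewrite /err_bound; set q := Num.sqrt s%:R in S1a EC EQ *.
set g := Num.sqrt (1 + dl) in aX EQ *.
have q0 : 0 <= q by exact: sqrtr_ge0.
have g0 : 0 <= g by exact: sqrtr_ge0.
have r0 : 0 < 1 - rho by lra.
have C0 : 0 < C by rewrite EC ltr_wpDr // mulr_ge0 // addr_ge0 // ltW.
have qa0 : 0 <= q + alpha by lra.
have Q0 : 0 < Q by rewrite EQ ltr_wpDr ?mulr_gt0 // mulr_ge0.
pose G := Q / (1 - rho).
have G0 : 0 < G by rewrite divr_gt0.
have EG : G = C + (q + alpha) * g / (1 - rho) by rewrite /G EQ; field; rewrite gt_eqF.
(* The bound [N <= a + S2] with [alpha <= 1] lets the left-hand [S2] of the cone inequality cancel;
   the sharper bound through [K] is kept for the end. *)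
have H1 : S1 + alpha * N + W + X - S2 <= G * X + C * W.
  have h1 : alpha * N <= alpha * a + S2.
    have := ler_wpM2l (ltW al0) N1; have : alpha * S2 <= S2 by rewrite ler_piMl.
    lra.
  have h2 := ler_wpM2l qa0 aX.
  have -> : G * X + C * W = X + W + (q + alpha) * (tau * (W + X) + g / (1 - rho) * X).
    by rewrite EG EC; field; rewrite gt_eqF.
  lra.
have H2 : X ^+ 2 <= 2 * lam * (G * X + C * W).
  have l2 : 0 <= 2 * lam by lra.
  by have := ler_wpM2l l2 H1; lra.
(* With [E1 = C W / G] and [E2 = 2 lam G], the inequality reads [X^2 <= E2 (X + E1)], which fails as
   soon as [X > E1 + E2]. *)
have XE : X <= C * W / G + 2 * lam * G.
  rewrite leNgt; apply/negP => lt.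
  have e0 : 0 <= C * W / G by apply: divr_ge0 (mulr_ge0 (ltW C0) W0) (ltW G0).
  have h0 : 0 < 2 * lam * G by apply: mulr_gt0 G0; lra.
  have CW : 2 * lam * (C * W) = (2 * lam * G) * (C * W / G) by field; rewrite gt_eqF.
  move: H2; rewrite mulrDr mulrA CW.
  set E1 := C * W / G in e0 lt *; set E2 := 2 * lam * G in h0 lt *.
  move=> H2; nra.
have Kg : 0 <= K * ((tau * (1 - rho) + g) / (1 - rho)) + 2^-1.
  apply: addr_ge0; last by rewrite invr_ge0.
  by exact: mulr_ge0 K0 (divr_ge0 (addr_ge0 (mulr_ge0 tau0 (ltW r0)) g0) (ltW r0)).
apply: (@le_trans _ _ (K * (tau * W) + W / 2
    + (K * ((tau * (1 - rho) + g) / (1 - rho)) + 2^-1) * X)).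
  have h := ler_wpM2l K0 aX.
  have E : K * (tau * (W + X) + g / (1 - rho) * X)
      = K * (tau * W) + K * ((tau * (1 - rho) + g) / (1 - rho)) * X.
    by field; rewrite gt_eqF.
  rewrite E in h; lra.
apply: (le_trans (lerD (lexx _) (ler_wpM2l Kg XE))).
rewrite -EG; have -> : C * W / G = C * (1 - rho) / Q * W by rewrite /G; field; rewrite !gt_eqF.
by rewrite le_eqVlt; apply/orP; left; apply/eqP; field; rewrite !gt_eqF.
Qed.

(** * Ceilings and numerical constants *)

Lemma nceil_ge (R : realType) (x : R) : 0 <= x -> x <= (nceil x)%:R.
Proof.
by move=> x0; rewrite /nceil natr_absz ger0_norm ?ceil_ge ?ceil_ge0 //; lra.
Qed.

Lemma nceil_lt (R : realType) (x : R) : 0 <= x -> (nceil x)%:R < x + 1.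
Proof.
move=> x0; rewrite /nceil natr_absz ger0_norm ?ceil_ge0; last lra.
by have := ceilB1_lt x; rewrite intrB ltrBlDr.
Qed.

(** The claim amounts to [sqrt 2 <= 16 / 11]; the convergent [17 / 12] lies between. *)
Lemma sqrt2_ratio_ge (R : realType) :
  3 / 2 * (9 / 8) <= (Num.sqrt 2 + 1) / Num.sqrt 2 :> R.
Proof.
have q0 : 0 < Num.sqrt 2 :> R by rewrite sqrtr_gt0; lra.
rewrite ler_pdivlMr //.
suff : Num.sqrt 2 <= 17 / 12 :> R by lra.
rewrite -(@ler_sqr R) ?nnegrE ?(ltW q0) //; last lra.
by rewrite sqr_sqrtr; lra.
Qed.

(** Squared, this is [x + 1 <= 81 / 64 x], valid from [x = 64 / 17] on. The threshold [4] is what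
    [t >= 3] and [s >= 2] give for [(t - 1) s]. *)
Lemma sqrt_nceil_le (R : realType) (x : R) :
  4 <= x -> Num.sqrt (nceil x)%:R <= 9 / 8 * Num.sqrt x.
Proof.
move=> x4; have x0 : 0 <= x by lra.
have k0 : 0 <= (nceil x)%:R :> R by exact: ler0n.
rewrite -ler_sqr ?nnegrE ?sqrtr_ge0 ?mulr_ge0 ?sqrtr_ge0 //; last lra.
rewrite exprMn !sqr_sqrtr //; have := nceil_lt x0; lra.
Qed.

(** * Bounds on the [s] largest entries of [y] for the two parts *)

(** For part (ii), [rip_estimate] is applied to [U] itself with both orders [s]. Once the common
    factor [g] is removed, the claim is a comparison of [3/2] with [(r2 + 1) / r2]. *)
Lemma l2norm_top_le (R : realType) (m n d : nat) (A : 'M[R]_(m, n))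
    (D : 'M[R]_(n, d)) h (U : {set 'I_d}) (s : nat) (alpha sig : R) :
  D *m D^T = 1%:M -> 0 <= alpha -> (2 <= s)%N -> #|U| = s -> 0 <= sig ->
  let y := D^T *m h in let ss := s%:R : R in let q := Num.sqrt ss in
  let r2 := Num.sqrt 2 : R in let a := l2norm (restr U y) in
  let vt := ((q + alpha) * a + sig) / (ss - q) in
  (forall i, i \in ~: U -> `|y i ord0| <= vt) ->
  \sum_(i in ~: U) `|y i ord0| <= ss * vt ->
  let dl := DRIC A D s in let th := DROC A D s s in
  let rho := dl + (r2 + 1) * (q + alpha) / (r2 * (q - 1)) * th in
  let tau := (r2 + 1) * th / (r2 * (1 - rho)) * (1 / (q - 1)) in
  rho < 1 -> a <= tau * sig + Num.sqrt (1 + dl) / (1 - rho) * l2norm (A *m h).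
Proof.
move=> DD al0 s2 cU sig0 y ss q r2 a vt ymax ysum dl th rho tau r1.
have qq : ss = q ^+ 2 by rewrite sqr_sqrtr ?ler0n.
have q1 : 1 < q by rewrite -[ltLHS]sqrtr1 ltr_sqrt ?ltr0n ?ltr1n // ltnW.
have q0 : 0 < q by lra.
have a0 : 0 <= a by exact: l2norm_ge0.
have sq : ss - q = q * (q - 1) by rewrite qq; ring.
have vt0 : 0 <= vt.
  apply: divr_ge0; last by rewrite sq; apply: mulr_ge0; lra.
  by apply: addr_ge0 => //; apply: mulr_ge0 => //; lra.
have r20 : 0 < r2 by rewrite sqrtr_gt0; lra.
have c0 : 3 / 2 * (9 / 8) <= (r2 + 1) / r2 by exact: sqrt2_ratio_ge.
have r1' : 0 < 1 - rho by lra.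
have q1' : 0 < q - 1 by lra.
have th0 : 0 <= th by exact: DROC_ge0.
have rip := rip_estimate A DD (ltnW s2) (eq_leq cU) vt0 ymax ysum.
apply: (contraction_bound r1 (lexx a) rip).
rewrite -/y -/a -/th -/dl -/ss -/q.
pose g := th / (q - 1); pose c := (r2 + 1) / r2.
have g0 : 0 <= g by apply: divr_ge0 => //; exact: ltW.
have -> : rho - dl = g * (c * (q + alpha)) by rewrite /rho /g /c; field; rewrite !gt_eqF.
have -> : (1 - rho) * (tau * sig) = g * (c * sig).
  by rewrite /tau /g /c; field; rewrite !gt_eqF.
have -> : th * (3 / 2 * (q * vt)) = g * (3 / 2 * ((q + alpha) * a + sig)).
  by rewrite /vt /g sq; field; rewrite !gt_eqF.
rewrite -(mulrA g) -mulrDr; apply: ler_wpM2l => //.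
rewrite -(mulrA c) -mulrDr; apply: ler_wpM2r; last by move: c0; rewrite -/c; lra.
by apply: addr_ge0 => //; apply: mulr_ge0 => //; lra.
Qed.

Lemma l2norm_top_le_t (R : realType) (m n d : nat) (A : 'M[R]_(m, n))
    (D : 'M[R]_(n, d)) h (U : {set 'I_d}) (s : nat) (alpha sig t : R) :
  D *m D^T = 1%:M -> 0 <= alpha -> (2 <= s)%N -> #|U| = s -> 0 <= sig ->
  let y := D^T *m h in let ss := s%:R : R in let q := Num.sqrt ss in
  let r2 := Num.sqrt 2 : R in let a := l2norm (restr U y) in
  let vt := ((q + alpha) * a + sig) / (ss - q) in
  (forall i, i \in ~: U -> `|y i ord0| <= vt) ->
  \sum_(i in ~: U) `|y i ord0| <= ss * vt ->
  3 <= t -> let k := nceil ((t - 1) * ss) in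
  let dl := DRIC A D (nceil (t * ss)) in let th := DROC A D (nceil (t * ss)) k in
  let rho := dl + Num.sqrt (k%:R / ((t - 1) ^+ 2 * ss))
                  * ((r2 + 1) * (q + alpha) / (r2 * (q - 1))) * th in
  let p := Num.sqrt ((t - 1) * ss) in
  let tau := (r2 + 1) * th / (r2 * (1 - rho)) * (p / ((t - 1) * (ss - q))) in
  rho < 1 -> a <= tau * sig + Num.sqrt (1 + dl) / (1 - rho) * l2norm (A *m h).
Proof.
move=> DD al0 s2 cU sig0 y ss q r2 a vt ymax ysum t3 k dl th rho p tau r1.
have ss2 : 2 <= ss by rewrite ler_nat.
have qq : ss = q ^+ 2 by rewrite sqr_sqrtr ?ler0n.
have q1 : 1 < q by rewrite -[ltLHS]sqrtr1 ltr_sqrt ?ltr0n ?ltr1n // ltnW.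
have q0 : 0 < q by lra.
have a0 : 0 <= a by exact: l2norm_ge0.
have sq : ss - q = q * (q - 1) by rewrite qq; ring.
have vt0 : 0 <= vt.
  apply: divr_ge0; last by rewrite sq; apply: mulr_ge0; lra.
  by apply: addr_ge0 => //; apply: mulr_ge0 => //; lra.
have r20 : 0 < r2 by rewrite sqrtr_gt0; lra.
have c0 : 3 / 2 * (9 / 8) <= (r2 + 1) / r2 by exact: sqrt2_ratio_ge.
have r1' : 0 < 1 - rho by lra.
have q1' : 0 < q - 1 by lra.
have th0 : 0 <= th by exact: DROC_ge0.
have ts0 : 0 <= t * ss by apply: mulr_ge0; [lra | exact: ler0n].
have t1 : 0 < t - 1 by lra.
have ts4 : 4 <= (t - 1) * ss by nra.
have kge : (t - 1) * ss <= k%:R by apply: nceil_ge; lra.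
have k0 : (0 < k)%N by rewrite -(ltr0n R); lra.
have p0 : 0 <= p by exact: sqrtr_ge0.
have kp : Num.sqrt k%:R <= 9 / 8 * p by exact: sqrt_nceil_le.
have Esk : Num.sqrt (k%:R / ((t - 1) ^+ 2 * ss)) = Num.sqrt k%:R / ((t - 1) * q).
  have h0 : 0 <= (t - 1) ^+ 2 * ss := mulr_ge0 (sqr_ge0 _) (ler0n _ _).
  rewrite sqrtrM ?ler0n // (sqrtrV h0).
  by rewrite sqrtrM ?sqr_ge0 // sqrtr_sqr gtr0_norm.
set vt' := vt / (t - 1).
have vt'0 : 0 <= vt' by apply: divr_ge0 vt0 (ltW t1).
have vtE : ss * vt = (t - 1) * ss * vt' by rewrite /vt'; field; rewrite gt_eqF.
pose V := [set i in ~: U | vt' < `|y i ord0|]%SET.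
(* Counting: the entries in [V] exceed [vt'] while their sum is at most [s vt = (t - 1) s vt'], so
   [U :|: V] has at most [t s] elements. *)
have sumV : #|V|%:R * vt' <= (t - 1) * ss * vt'.
  rewrite -vtE; apply: le_trans ysum; rewrite (big_setID V) /=.
  have -> : ~: U :&: V = V.
    by apply/setP => i; rewrite !inE andbA andbb.
  rewrite ler_wpDr ?sumr_ge0 //; apply: cards_le_sum => i.
  by rewrite !inE => /andP[_ /ltW].
have cV : #|V|%:R <= (t - 1) * ss.
  (* If [vt' = 0], then [y] vanishes off [U] and [V] is empty. *)
  move: vt'0; rewrite le0r => /orP[/eqP vt'E|vt'p]; last by rewrite -(ler_pM2r vt'p).
  suff -> : V = finset.set0 by rewrite cards0; lra.
  apply/setP => i; rewrite !inE; apply/negP => /andP[iU].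
  rewrite ltNge => /negP; apply.
  have : `|y i ord0| <= \sum_(i in ~: U) `|y i ord0|.
    by rewrite (big_setD1 i) ?inE //= lerDl sumr_ge0.
  by move/le_trans; apply; rewrite vt'E (le_trans ysum) // vtE vt'E mulr0.
have cUV : (#|U :|: V| <= nceil (t * ss))%N.
  rewrite -(ler_nat R); apply: le_trans (nceil_ge ts0).
  apply: (@le_trans _ _ (#|U| + #|V|)%:R).
    by rewrite ler_nat cardsU leq_subr.
  rewrite natrD cU -/ss; lra.
have ymaxV i : i \in ~: (U :|: V) -> `|y i ord0| <= vt'.
  by rewrite !inE negb_or => /andP[-> /=]; rewrite -leNgt.
have ysumV : \sum_(i in ~: (U :|: V)) `|y i ord0| <= k%:R * vt'.
  apply: le_trans (ler_wpM2r vt'0 kge); rewrite -vtE; apply: le_trans ysum.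
  rewrite [leRHS](big_setID (~: (U :|: V))) /=.
  have -> : ~: U :&: ~: (U :|: V) = ~: (U :|: V).
    by apply/setP => i; rewrite !inE; case: (i \in U).
  by rewrite lerDl sumr_ge0.
have rip := rip_estimate A DD k0 cUV vt'0 ymaxV ysumV.
have aa : a <= l2norm (restr (U :|: V) y) by apply/l2norm_restr_mono/finset.subsetUl.
apply: (contraction_bound r1 aa rip).
rewrite -/y -/th -/dl; set a' := l2norm _ in aa *; set sk := Num.sqrt k%:R in kp Esk *.
have sk0 : 0 <= sk by exact: sqrtr_ge0.
pose g := th / ((t - 1) * q * (q - 1)); pose c := (r2 + 1) / r2.
have g0 : 0 <= g by apply: divr_ge0 => //; apply/mulr_ge0/ltW; [apply: mulr_ge0; lra | lra].
have -> : rho - dl = g * (c * (sk * (q + alpha))).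
  by rewrite /rho Esk /g /c; field; rewrite !gt_eqF.
have -> : (1 - rho) * (tau * sig) = g * (c * (p * sig)).
  by rewrite /tau /g /c sq; field; rewrite !gt_eqF.
have -> : th * (3 / 2 * (sk * vt')) = g * (3 / 2 * (sk * (q + alpha) * a + sk * sig)).
  by rewrite /vt' /vt /g sq; field; rewrite !gt_eqF.
(* The coefficient of [a] needs only [3/2 <= c], since [rho] contains the ceiling [k]. The
   coefficient of [sig] also needs the factor [9/8], since [tau] contains [(t - 1) s] without the
   ceiling. *)
rewrite -(mulrA g) -mulrDr; apply: ler_wpM2l => //.
have skq : 0 <= sk * (q + alpha) by apply: mulr_ge0 => //; lra.
have h1 := ler_wpM2l skq aa.
have h2 := ler_wpM2r sig0 kp.
have c32 : 3 / 2 <= c by move: c0; rewrite -/c; lra.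
have h3 := ler_wpM2r (mulr_ge0 skq (le_trans a0 aa)) c32.
have h4 := ler_wpM2r (mulr_ge0 p0 sig0) c0.
move: h3 h4; rewrite -/c; lra.
Qed.

(** * Assembly of the error bound *)

Theorem theorem2 (R : realType) (m n d : nat)
  (A : 'M[R]_(m, n)) (D : 'M[R]_(n, d)) (alpha lam mu : R) (s : nat)
  (x : 'cV[R]_n) (e : 'cV[R]_m) (b : 'cV[R]_m) (T : {set 'I_d})
  (xh : 'cV[R]_n) (zh : 'cV[R]_d) :
  D *m D^T = 1%:M ->
  0 < alpha -> alpha <= 1 -> 0 < lam -> 0 < mu -> (2 <= s)%N ->
  b = A *m x + e -> l2norm e <= lam ->
  #|T| = s ->
  (forall i j, i \in T -> j \notin T -> `|(D^T *m x) j ord0| <= `|(D^T *m x) i ord0|) ->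
  (forall (x' : 'cV[R]_n) (z' : 'cV[R]_d),
     objective A D b alpha lam mu xh zh <= objective A D b alpha lam mu x' z') ->
  let K := Kconst alpha s in
  let W := 2 * (\sum_(i < d | i \notin T) `|(D^T *m x) i ord0|)
           + (alpha + 1) ^+ 2 * d%:R / 2 * (lam / mu) in
  let ss := s%:R : R in
  let r2 := Num.sqrt 2 : R in
  (* part (i) *)
  (forall t : R, 3 <= t ->
     let dl := DRIC A D (nceil (t * ss)) in
     let th := DROC A D (nceil (t * ss)) (nceil ((t - 1) * ss)) in
     let rho := dl + Num.sqrt ((nceil ((t - 1) * ss))%:R / ((t - 1) ^+ 2 * ss))
                     * ((r2 + 1) * (Num.sqrt ss + alpha) / (r2 * (Num.sqrt ss - 1))) * th in
     rho < 1 ->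
     let tau := (r2 + 1) * th / (r2 * (1 - rho))
                * (Num.sqrt ((t - 1) * ss) / ((t - 1) * (ss - Num.sqrt ss))) in
     let C := 1 + (r2 + 1) * th / (r2 * (1 - rho))
                  * ((Num.sqrt ss + alpha) / (ss - Num.sqrt ss))
                  * (Num.sqrt ((t - 1) * ss) / (t - 1)) in
     let Q := C * (1 - rho) + (Num.sqrt ss + alpha) * Num.sqrt (1 + dl) in
     l2norm (xh - x) <= err_bound alpha s K W lam rho dl tau C Q)
  /\
  (* part (ii) *)
  (let dl := DRIC A D s in
   let th := DROC A D s s in
   let rho := dl + (r2 + 1) * (Num.sqrt ss + alpha) / (r2 * (Num.sqrt ss - 1)) * th in
   rho < 1 ->
   let tau := (r2 + 1) * th / (r2 * (1 - rho)) * (1 / (Num.sqrt ss - 1)) in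
   let C := 1 + (r2 + 1) * th / (r2 * (1 - rho)) * ((Num.sqrt ss + alpha) / (Num.sqrt ss - 1)) in
   let Q := C * (1 - rho) + (Num.sqrt ss + alpha) * Num.sqrt (1 + dl) in
   l2norm (xh - x) <= err_bound alpha s K W lam rho dl tau C Q).
Proof.
move=> DD al0 al1 lam0 mu0 s2 -> elam cT _ opt K W ss r2.
have d0 : (0 < d)%N.
  by have := max_card (mem T); rewrite card_ord cT; apply: leq_trans; apply: ltnW.
pose h := xh - x; pose y := D^T *m h; pose X := l2norm (A *m h).
have X0 : 0 <= X by exact: l2norm_ge0.
have W0 : 0 <= W.
  apply: addr_ge0; first by apply: mulr_ge0 => //; exact: sumr_ge0.
  apply: mulr_ge0; last by apply: divr_ge0; exact: ltW.
  by apply: divr_ge0 => //; apply: mulr_ge0 (sqr_ge0 _) (ler0n _ _).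
have [U [_ cU Umax]] : exists U : {set 'I_d}, [/\ U \subset ~: finset.set0, #|U| = s &
    forall i j, i \in U -> j \in ~: finset.set0 :\: U -> `|y j ord0| <= `|y i ord0|].
  apply: (exists_top (fun i => `|y i ord0|)).
  by rewrite cardsCs finset.setCK cards0 subn0 -cT max_card.
have {}Umax i j : i \in U -> j \notin U -> `|y j ord0| <= `|y i ord0|.
  by move=> iU jU; apply: Umax => //; rewrite !inE jU.
set S1 := \sum_(i in U) `|y i ord0|; set S2 := \sum_(i in ~: U) `|y i ord0|.
pose a := l2norm (restr U y); pose v := l2norm (restr (~: U) y).
have a0 : 0 <= a by exact: l2norm_ge0.
have v0 : 0 <= v by exact: l2norm_ge0.
have S20 : 0 <= S2 by exact: sumr_ge0.
have cone : X ^+ 2 + 2 * lam * S2 <= 2 * lam * (S1 + alpha * l2norm y + W + X).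
  have := objective_cone T d0 (ltW al0) lam0 mu0 elam (opt x (D^T *m x)).
  cbv zeta; rewrite -/h -/y -/X -/W.
  (* Passing from [T] to [U] keeps the total [l1norm y] and can only enlarge the sum over the set,
     so the cone inequality persists. *)
  have TU : \sum_(i in T) `|y i ord0| <= S1.
    by apply: (@sum_le_top _ _ (fun i => `|y i ord0|)); rewrite ?cT.
  have ST : \sum_(i in T) `|y i ord0| + \sum_(i in ~: T) `|y i ord0| = S1 + S2.
    have E (V : {set 'I_d}) :
        \sum_(i in V) `|y i ord0| + \sum_(i in ~: V) `|y i ord0| = l1norm y.
      rewrite /l1norm [RHS](bigID (mem V)) /=; congr (_ + _).
      by apply: eq_bigl => i; rewrite inE.
    by rewrite !E.
  move=> H; have H2 : 2 * lam * \sum_(i in T) `|y i ord0| <= 2 * lam * S1.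
    by apply: ler_wpM2l => //; lra.
  have H3 : 2 * lam * \sum_(i in ~: T) `|y i ord0|
      = 2 * lam * (S1 + S2) - 2 * lam * \sum_(i in T) `|y i ord0|.
    by rewrite -ST; ring.
  lra.
have Nh : l2norm h = l2norm y by rewrite l2norm_tight_tr.
have Nav : l2norm y <= a + v by rewrite -{1}(restrC U y); exact: l2normD.
have q1 : 1 < Num.sqrt ss.
  by rewrite -[ltLHS]sqrtr1 ltr_sqrt ?ltr0n ?ltr1n // ltnW.
have qq : ss = Num.sqrt ss ^+ 2 by rewrite sqr_sqrtr ?ler0n.
set q := Num.sqrt ss in q1 qq *.
have q0 : 0 < q by lra.
have S1a : S1 <= q * a by have := sum_abs_le_l2norm U y; rewrite cU.
set sig := W + X; have sig0 : 0 <= sig by exact: addr_ge0.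
have S2P : S2 <= q * a + alpha * l2norm y + sig.
  have l2 : 0 < 2 * lam by lra.
  rewrite -(ler_pM2l l2); have := ler_wpM2l (ltW l2) S1a; have := sqr_ge0 X.
  rewrite /sig; lra.
have aly : alpha * l2norm y <= alpha * (a + v) by rewrite ler_pM2l.
(* An entry off [U] is at most the mean of those on [U], which is at most [q a / s = a / q]. *)
have vinf i : i \in ~: U -> `|y i ord0| <= a / q.
  rewrite inE => iU; rewrite ler_pdivlMr // -(ler_pM2l q0).
  have -> : q * (`|y i ord0| * q) = #|U|%:R * `|y i ord0| by rewrite cU -/ss qq; ring.
  by apply: (le_trans _ S1a); apply: cards_le_sum => j jU; exact: Umax.
have vsq : v ^+ 2 <= a / q * (q * a + alpha * (a + v) + sig).
  apply: (le_trans (sqr_l2norm_le_max vinf)); apply: ler_wpM2l; last by rewrite -/S2; lra.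
  by apply: divr_ge0 => //; exact: ltW.
have vS2 : v <= S2.
  rewrite -ler_sqr ?nnegrE //; apply: (le_trans (sqr_l2norm_le_max (vt := S2) _)).
    by move=> i iU; rewrite /S2 (big_setD1 i) //= lerDl sumr_ge0.
  by rewrite -/S2 expr2.
have NK : l2norm y <= K * a + sig / 2.
  apply: (le_trans Nav); apply: Kconst_bound => //; [exact: ltnW | exact: ltW].
have K0 : 0 <= K.
  apply: addr_ge0; last exact: ler01.
  apply: addr_ge0; first exact: sqrtr_ge0.
  by apply: divr_ge0; [lra | exact: mulr_ge0 (ler0n _ 2) (sqrtr_ge0 _)].
(* Common end of both parts: only the bound on [a] depends on how [rho] and [tau] are chosen. *)
have core rho dl tau C : rho < 1 -> 0 <= tau -> C = 1 + (q + alpha) * tau ->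
    a <= tau * sig + Num.sqrt (1 + dl) / (1 - rho) * X ->
    l2norm (xh - x) <= err_bound alpha s K W lam rho dl tau C
      (C * (1 - rho) + (q + alpha) * Num.sqrt (1 + dl)).
  move=> r1 t0 EC aX; rewrite -/h Nh.
  apply: (@err_bound_ge _ _ _ _ _ X a _ S1 S2) => //.
  by apply: (le_trans Nav); rewrite lerD2l.
(* Chosen so that [S2 <= q a + alpha (a + v) + sig] becomes [S2 - alpha v <= (s - sqrt s) vt], the
   hypothesis of [l1norm_le_of_l1_sub_l2]. *)
set vt := ((q + alpha) * a + sig) / (ss - q).
have sq0 : 0 < ss - q.
  have -> : ss - q = q * (q - 1) by rewrite qq; ring.
  by apply: mulr_gt0; lra.
have vt0 : 0 <= vt.
  by apply: divr_ge0 (ltW sq0); apply: addr_ge0 => //; apply: mulr_ge0 => //; lra.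
have ymax i : i \in ~: U -> `|y i ord0| <= vt.
  move=> iU; apply: (le_trans (vinf i iU)); rewrite ler_pdivlMr //.
  have -> : a / q * (ss - q) = q * a - a by rewrite qq; field; rewrite gt_eqF.
  have := mulr_ge0 (ltW al0) a0; lra.
have ysum : S2 <= ss * vt.
  apply: (l1norm_le_of_l1_sub_l2 (alpha := alpha)) => //; first exact: ltnW.
  rewrite -/S2 -/v -/ss -/q [leRHS]mulrC divfK ?gt_eqF //; lra.
have r20 : 0 < r2 by rewrite sqrtr_gt0; lra.
split.
- move=> t t3 dl th rho r1.
  pose p := Num.sqrt ((t - 1) * ss).
  pose tau := (r2 + 1) * th / (r2 * (1 - rho)) * (p / ((t - 1) * (ss - q))).
  pose C := 1 + (r2 + 1) * th / (r2 * (1 - rho)) * ((q + alpha) / (ss - q)) * (p / (t - 1)).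
  have r0 : 0 < r2 * (1 - rho) by apply: mulr_gt0; lra.
  have th0 : 0 <= th by exact: DROC_ge0.
  have p0 : 0 <= p by exact: sqrtr_ge0.
  have t1 : 0 < t - 1 by lra.
  have tau0 : 0 <= tau.
    apply: mulr_ge0; apply: divr_ge0 => //; try exact: ltW.
      by apply: mulr_ge0 => //; lra.
    by apply: mulr_ge0; exact: ltW.
  refine (core rho dl tau C r1 tau0 _ _).
    by rewrite /C /tau; field; rewrite !gt_eqF //; lra.
  exact: (l2norm_top_le_t DD (ltW al0) s2 cU sig0 ymax ysum t3 r1).
move=> dl th rho r1.
pose tau := (r2 + 1) * th / (r2 * (1 - rho)) * (1 / (q - 1)).
pose C := 1 + (r2 + 1) * th / (r2 * (1 - rho)) * ((q + alpha) / (q - 1)).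
have r0 : 0 < r2 * (1 - rho) by apply: mulr_gt0; lra.
have th0 : 0 <= th by exact: DROC_ge0.
have tau0 : 0 <= tau.
  apply: mulr_ge0; apply: divr_ge0 => //; try exact: ltW; try lra.
  by apply: mulr_ge0 => //; lra.
refine (core rho dl tau C r1 tau0 _ _).
  by rewrite /C /tau; field; rewrite !gt_eqF //; lra.
exact: (l2norm_top_le DD (ltW al0) s2 cU sig0 ymax ysum r1).
Qed.
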